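(* Let $\mathcal C$ be a braided closed monoidal category that is (ExtrEpi, Mono)-structured, let $A$ be an $\Omega$-magma in $\mathcal C$, and let $i\colon V\to[A,A]$ be a submonoid such that the $V$-universal coacting bimonoid $\mathcal B^\square(A,V)$ exists. Suppose, in addition, that the forgetful functor $\mathbf{Hopf}(\mathcal C)\to\mathbf{Bimon}(\mathcal C)$ admits a left adjoint functor $H_l\colon\mathbf{Bimon}(\mathcal C)\to\mathbf{Hopf}(\mathcal C)$. Then there exists an initial object in the category $\mathbf{HCoact}_V(A)$ of coactions $\rho\colon A\to A\otimes H$ of arbitrary Hopf monoids $H$ such that $K(\rho^\vee)\colon H^*\to[A,A]$ factors through $i$ (i.e. the $V$-universal coacting Hopf monoid on $A$ exists).
   Context: Associativity and unit constraints are suppressed; $c$ is the braiding and $\mathbf 1$ the monoidal unit; $\mathbf{Bimon}(\mathcal C)$ and $\mathbf{Hopf}(\mathcal C)$ are the categories of bimonoids and Hopf monoids in $\mathcal C$. (ExtrEpi, Mono)-structured: every morphism factors as an extremal epimorphism followed by a monomorphism, and the unique diagonalization property holds for these two classes. $\Omega$ is a fixed set with maps $s,t\colon\Omega\to\mathbb Z_{\geq 0}$. An $\Omega$-magma in $\mathcal C$ is an object $A$ with morphisms $\omega_A\colon A^{\otimes s(\omega)}\to A^{\otimes t(\omega)}$ for all $\omega\in\Omega$ ($A^{\otimes 0}=\mathbf 1$; no identities are required). For a monoid $(Q,\mu,u)$ and $\rho_i\colon A_i\to B_i\otimes Q$, put $\rho_1\tilde\otimes\rho_2=(\mathrm{id}_{B_1\otimes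 B_2}\otimes\mu)(\mathrm{id}_{B_1}\otimes c_{Q,B_2}\otimes \mathrm{id}_Q)(\rho_1\otimes\rho_2)$; $\rho^{\tilde\otimes n}$ is the iterated product, $\rho^{\tilde\otimes 0}$ is $\mathbf 1\xrightarrow{u}Q\cong\mathbf 1\otimes Q$. A comeasuring from $A$ to $B$ is a morphism $\rho\colon A\to B\otimes Q$, $Q$ a monoid, with $\rho^{\tilde\otimes t(\omega)}\omega_A=(\omega_B\otimes \mathrm{id}_Q)\rho^{\tilde\otimes s(\omega)}$ for all $\omega\in\Omega$. For a bimonoid $Q$, a coaction of $Q$ on $A$ is a comeasuring $A\to A\otimes Q$ that is a right $Q$-comodule structure. Closed means that each $(-)\otimes A$ has a right adjoint $[A,-]$ with counit $\mathrm{ev}_{A,B}\colon[A,B]\otimes A\to B$; $A^*:=[A,\mathbf 1]$, $\mathrm{ev}_A:=\mathrm{ev}_{A,\mathbf 1}$. For $\psi\colon P\otimes A\to B$, $K\psi\colon P\to[A,B]$ is the morphism with $\mathrm{ev}_{A,B}(K\psi\otimes \mathrm{id}_A)=\psi$. $[A,A]$ is a monoid in the unique way making $\mathrm{ev}_{A,A}$ a left module structure on $A$; a submonoid $i\colon V\to[A,A]$ is a monoid homomorphism that is a monomorphism in $\mathcal C$. For $\rho\colon A\to B\otimes Q$, $\rho^\vee\colon Q^*\otimes A\to B$ is $(\mathrm{id}_B\otimes \mathrm{ev}_Q)(c_{Q^*,B}\otimes \mathrm{id}_Q)(\mathrm{id}_{Q^*}\otimes\rho)$. The $V$-universal coacting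 bimonoid $\mathcal B^\square(A,V)$ is the bimonoid of the initial object in the category of coactions $\rho\colon A\to A\otimes B$ ($B$ any bimonoid) such that $K(\rho^\vee)$ factors through $i$, morphisms $\rho_1\to\rho_2$ being bimonoid homomorphisms $\varphi\colon B_1\to B_2$ with $(\mathrm{id}_A\otimes\varphi)\rho_1=\rho_2$. Morphisms of $\mathbf{HCoact}_V(A)$ are defined in the same way with Hopf monoid homomorphisms. *)

(* Defs.v *)
(* Plain Rocq with the standard library; categories are defined here, with
   Leibniz equality of morphisms.  Proof irrelevance is only used to compare
   morphisms of categories of structured objects (pairs of a morphism and a
   proof). *)
From Stdlib Require Import ProofIrrelevance.

Set Implicit Arguments.
Unset Strict Implicit.
Unset Printing Implicit Defensive.

Record Category : Type := {
  Obj :> Type;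
  Hom : Obj -> Obj -> Type;
  idm : forall X, Hom X X;
  comp : forall X Y Z, Hom Y Z -> Hom X Y -> Hom X Z;
  comp_idl : forall X Y (f : Hom X Y), comp (idm Y) f = f;
  comp_idr : forall X Y (f : Hom X Y), comp f (idm X) = f;
  comp_assoc : forall X Y Z W (h : Hom Z W) (g : Hom Y Z) (f : Hom X Y),
    comp h (comp g f) = comp (comp h g) f
}.

Arguments Hom {c} X Y.
Arguments idm {c} X.
Arguments comp {c X Y Z} g f.

Declare Scope cat_scope.
Delimit Scope cat_scope with cat.
Open Scope cat_scope.

Notation "g ∘ f" := (comp g f) (at level 40, left associativity) : cat_scope.

Definition is_mono (C : Category) (X Y : C) (m : Hom X Y) : Prop :=
  forall (Z : C) (f g : Hom Z X), m ∘ f = m ∘ g -> f = g.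

Definition is_epi (C : Category) (X Y : C) (e : Hom X Y) : Prop :=
  forall (Z : C) (f g : Hom Y Z), f ∘ e = g ∘ e -> f = g.

Definition is_iso (C : Category) (X Y : C) (f : Hom X Y) : Prop :=
  exists g : Hom Y X, g ∘ f = idm X /\ f ∘ g = idm Y.

Definition is_extremal_epi (C : Category) (X Y : C) (e : Hom X Y) : Prop :=
  is_epi e /\
  forall (Z : C) (m : Hom Z Y) (g : Hom X Z),
    is_mono m -> e = m ∘ g -> is_iso m.

Definition ExtrEpi_Mono_structured (C : Category) : Prop :=
  (forall (X Y : C) (f : Hom X Y),
     exists (Z : C) (e : Hom X Z) (m : Hom Z Y),
       is_extremal_epi e /\ is_mono m /\ f = m ∘ e) /\
  (forall (X Y Z W : C) (e : Hom X Y) (m : Hom Z W)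
          (f : Hom X Z) (g : Hom Y W),
     is_extremal_epi e -> is_mono m -> g ∘ e = m ∘ f ->
     exists! d : Hom Y Z, d ∘ e = f /\ m ∘ d = g).

Definition is_initial (C : Category) (I : C) : Prop :=
  forall X : C, exists f : Hom I X, forall g : Hom I X, g = f.

Definition has_initial (C : Category) : Prop := exists I : C, is_initial I.

Record Functor (C D : Category) : Type := {
  fobj :> C -> D;
  fmap : forall X Y, Hom X Y -> Hom (fobj X) (fobj Y);
  fmap_id : forall X, fmap (idm X) = idm (fobj X);
  fmap_comp : forall X Y Z (g : Hom Y Z) (f : Hom X Y),
    fmap (g ∘ f) = fmap g ∘ fmap f
}.

Arguments fmap {C D} _ {X Y} _.

Record Adjunction (C D : Category) (L : Functor C D) (R : Functor D C)
    : Type := {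
  adj_unit : forall X : C, Hom X (R (L X));
  adj_counit : forall Y : D, Hom (L (R Y)) Y;
  adj_unit_nat : forall (X X' : C) (f : Hom X X'),
    adj_unit X' ∘ f = fmap R (fmap L f) ∘ adj_unit X;
  adj_counit_nat : forall (Y Y' : D) (g : Hom Y Y'),
    adj_counit Y' ∘ fmap L (fmap R g) = g ∘ adj_counit Y;
  adj_triangleL : forall X : C,
    adj_counit (L X) ∘ fmap L (adj_unit X) = idm (L X);
  adj_triangleR : forall Y : D,
    fmap R (adj_counit Y) ∘ adj_unit (R Y) = idm (R Y)
}.

Lemma adj_transposeK (C D : Category) (L : Functor C D) (R : Functor D C)
    (a : Adjunction L R) (X : C) (Y : D) (psi : Hom (L X) Y) :
  adj_counit a Y ∘ fmap L (fmap R psi ∘ adj_unit a X) = psi.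
Proof.
  rewrite fmap_comp, comp_assoc, adj_counit_nat, <- comp_assoc.
  now rewrite adj_triangleL, comp_idr.
Qed.

Lemma adj_transpose_unique (C D : Category) (L : Functor C D)
    (R : Functor D C) (a : Adjunction L R) (X : C) (Y : D)
    (psi : Hom (L X) Y) (k : Hom X (R Y)) :
  adj_counit a Y ∘ fmap L k = psi -> k = fmap R psi ∘ adj_unit a X.
Proof.
  intros <-.
  rewrite fmap_comp, <- comp_assoc, <- adj_unit_nat, comp_assoc.
  now rewrite adj_triangleR, comp_idl.
Qed.

Record MonoidalCategory : Type := {
  mc_cat :> Category;
  tens : mc_cat -> mc_cat -> mc_cat;
  tensm : forall (X X' Y Y' : mc_cat),
    Hom X X' -> Hom Y Y' -> Hom (tens X Y) (tens X' Y');
  one : mc_cat;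
  assoc : forall X Y Z, Hom (tens (tens X Y) Z) (tens X (tens Y Z));
  associ : forall X Y Z, Hom (tens X (tens Y Z)) (tens (tens X Y) Z);
  lunit : forall X, Hom (tens one X) X;
  luniti : forall X, Hom X (tens one X);
  runit : forall X, Hom (tens X one) X;
  runiti : forall X, Hom X (tens X one);
  tensm_id : forall X Y, tensm (idm X) (idm Y) = idm (tens X Y);
  tensm_comp : forall X X' X'' Y Y' Y''
      (g : Hom X' X'') (f : Hom X X') (k : Hom Y' Y'') (h : Hom Y Y'),
    tensm (g ∘ f) (k ∘ h) = tensm g k ∘ tensm f h;
  assoc_nat : forall X X' Y Y' Z Z'
      (f : Hom X X') (g : Hom Y Y') (h : Hom Z Z'),
    assoc X' Y' Z' ∘ tensm (tensm f g) h
    = tensm f (tensm g h) ∘ assoc X Y Z;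
  lunit_nat : forall X Y (f : Hom X Y),
    lunit Y ∘ tensm (idm one) f = f ∘ lunit X;
  runit_nat : forall X Y (f : Hom X Y),
    runit Y ∘ tensm f (idm one) = f ∘ runit X;
  assocK : forall X Y Z, associ X Y Z ∘ assoc X Y Z = idm _;
  associK : forall X Y Z, assoc X Y Z ∘ associ X Y Z = idm _;
  lunitK : forall X, luniti X ∘ lunit X = idm _;
  lunitiK : forall X, lunit X ∘ luniti X = idm _;
  runitK : forall X, runiti X ∘ runit X = idm _;
  runitiK : forall X, runit X ∘ runiti X = idm _;
  pentagon : forall X Y Z W,
    assoc X Y (tens Z W) ∘ assoc (tens X Y) Z W
    = tensm (idm X) (assoc Y Z W) ∘ assoc X (tens Y Z) W
      ∘ tensm (assoc X Y Z) (idm W);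
  triangle : forall X Y,
    tensm (idm X) (lunit Y) ∘ assoc X one Y = tensm (runit X) (idm Y)
}.

Arguments tens {m} X Y.
Arguments tensm {m X X' Y Y'} f g.
Arguments one {m}.
Arguments assoc {m} X Y Z.
Arguments associ {m} X Y Z.
Arguments lunit {m} X.
Arguments luniti {m} X.
Arguments runit {m} X.
Arguments runiti {m} X.

Notation "X ⊗ Y" := (tens X Y) (at level 36, left associativity) : cat_scope.
Notation "f ⊗m g" := (tensm f g) (at level 36, left associativity)
  : cat_scope.

Record BraidedCategory : Type := {
  bc_mon :> MonoidalCategory;
  braid : forall X Y : bc_mon, Hom (X ⊗ Y) (Y ⊗ X);
  braidi : forall X Y : bc_mon, Hom (Y ⊗ X) (X ⊗ Y);
  braidK : forall X Y : bc_mon, braidi X Y ∘ braid X Y = idm _;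
  braidiK : forall X Y : bc_mon, braid X Y ∘ braidi X Y = idm _;
  braid_nat : forall (X X' Y Y' : bc_mon) (f : Hom X X') (g : Hom Y Y'),
    braid X' Y' ∘ (f ⊗m g) = (g ⊗m f) ∘ braid X Y;
  hexagon1 : forall X Y Z : bc_mon,
    assoc Y Z X ∘ braid X (Y ⊗ Z) ∘ assoc X Y Z
    = (idm Y ⊗m braid X Z) ∘ assoc Y X Z ∘ (braid X Y ⊗m idm Z);
  hexagon2 : forall X Y Z : bc_mon,
    associ Z X Y ∘ braid (X ⊗ Y) Z ∘ associ X Y Z
    = (braid X Z ⊗m idm Y) ∘ associ X Z Y ∘ (idm X ⊗m braid Y Z)
}.

Arguments braid {b} X Y.
Arguments braidi {b} X Y.

Section TensorRight.
Context (C : MonoidalCategory) (A : C).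

Lemma tensR_id (X : C) : idm X ⊗m idm A = idm (X ⊗ A).
Proof. apply tensm_id. Qed.

Lemma tensR_comp (X Y Z : C) (g : Hom Y Z) (f : Hom X Y) :
  (g ∘ f) ⊗m idm A = (g ⊗m idm A) ∘ (f ⊗m idm A).
Proof. now rewrite <- tensm_comp, comp_idl. Qed.

Definition tensR : Functor C C := {|
  fobj := fun X => X ⊗ A;
  fmap := fun X Y f => f ⊗m idm A;
  fmap_id := tensR_id;
  fmap_comp := tensR_comp
|}.
End TensorRight.

Record BraidedClosedCategory : Type := {
  bcc_braided :> BraidedCategory;
  ihomF : forall A : bcc_braided, Functor bcc_braided bcc_braided;
  ihom_adj : forall A : bcc_braided, Adjunction (tensR A) (ihomF A)
}.

Record MonoidOn (C : MonoidalCategory) (M : C) : Type := {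
  mul : Hom (M ⊗ M) M;
  unt : Hom one M;
  mul_assoc :
    mul ∘ (mul ⊗m idm M) = mul ∘ (idm M ⊗m mul) ∘ assoc M M M;
  mul_unitl : mul ∘ (unt ⊗m idm M) = lunit M;
  mul_unitr : mul ∘ (idm M ⊗m unt) = runit M
}.

Record ComonoidOn (C : MonoidalCategory) (M : C) : Type := {
  comul : Hom M (M ⊗ M);
  counit : Hom M one;
  comul_assoc :
    assoc M M M ∘ (comul ⊗m idm M) ∘ comul = (idm M ⊗m comul) ∘ comul;
  comul_unitl : lunit M ∘ (counit ⊗m idm M) ∘ comul = idm M;
  comul_unitr : runit M ∘ (idm M ⊗m counit) ∘ comul = idm M
}.

Definition is_monoid_hom (C : MonoidalCategory) (M N : C)
    (m : MonoidOn M) (n : MonoidOn N) (f : Hom M N) : Prop :=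
  f ∘ mul m = mul n ∘ (f ⊗m f) /\ f ∘ unt m = unt n.

Definition is_comonoid_hom (C : MonoidalCategory) (M N : C)
    (m : ComonoidOn M) (n : ComonoidOn N) (f : Hom M N) : Prop :=
  comul n ∘ f = (f ⊗m f) ∘ comul m /\ counit n ∘ f = counit m.

Record Submonoid (C : MonoidalCategory) (E : C) (e : MonoidOn E) : Type := {
  sub_obj : C;
  sub_mon : MonoidOn sub_obj;
  sub_incl : Hom sub_obj E;
  sub_hom : is_monoid_hom sub_mon e sub_incl;
  sub_mono : is_mono sub_incl
}.

(** [id ⊗ c_{Y,Z} ⊗ id], with the associativity constraints restored. *)
Definition midswap (C : BraidedCategory) (X Y Z W : C)
    : Hom ((X ⊗ Y) ⊗ (Z ⊗ W)) ((X ⊗ Z) ⊗ (Y ⊗ W)) :=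
  associ X Z (Y ⊗ W)
  ∘ (idm X ⊗m (assoc Z Y W ∘ (braid Y Z ⊗m idm W) ∘ associ Y Z W))
  ∘ assoc X Y (Z ⊗ W).

Record Bimonoid (C : BraidedCategory) : Type := {
  bm_obj :> C;
  bm_mon : MonoidOn bm_obj;
  bm_com : ComonoidOn bm_obj;
  bm_comul_mul :
    comul bm_com ∘ mul bm_mon
    = (mul bm_mon ⊗m mul bm_mon) ∘ midswap bm_obj bm_obj bm_obj bm_obj
      ∘ (comul bm_com ⊗m comul bm_com);
  bm_comul_unt :
    comul bm_com ∘ unt bm_mon = (unt bm_mon ⊗m unt bm_mon) ∘ luniti one;
  bm_counit_mul :
    counit bm_com ∘ mul bm_mon
    = lunit one ∘ (counit bm_com ⊗m counit bm_com);
  bm_counit_unt : counit bm_com ∘ unt bm_mon = idm one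
}.

Record HopfMonoid (C : BraidedCategory) : Type := {
  hm_bim :> Bimonoid C;
  antipode : Hom (hm_bim : C) (hm_bim : C);
  antipode_l :
    mul (bm_mon hm_bim) ∘ (antipode ⊗m idm _) ∘ comul (bm_com hm_bim)
    = unt (bm_mon hm_bim) ∘ counit (bm_com hm_bim);
  antipode_r :
    mul (bm_mon hm_bim) ∘ (idm _ ⊗m antipode) ∘ comul (bm_com hm_bim)
    = unt (bm_mon hm_bim) ∘ counit (bm_com hm_bim)
}.

Definition is_bimonoid_hom (C : BraidedCategory) (B1 B2 : Bimonoid C)
    (f : Hom (B1 : C) (B2 : C)) : Prop :=
  is_monoid_hom (bm_mon B1) (bm_mon B2) f /\
  is_comonoid_hom (bm_com B1) (bm_com B2) f.

Section CategoriesOfBimonoids.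
Context (C : BraidedCategory).

Definition BimonHom (B1 B2 : Bimonoid C) : Type :=
  { f : Hom (B1 : C) (B2 : C) | is_bimonoid_hom f }.

Lemma bimonoid_hom_id (B : Bimonoid C) :
  is_bimonoid_hom (B1 := B) (B2 := B) (idm B).
Proof.
  repeat split; now rewrite ?tensm_id, ?comp_idl, ?comp_idr.
Qed.

Lemma bimonoid_hom_comp (B1 B2 B3 : Bimonoid C)
    (g : Hom (B2 : C) (B3 : C)) (f : Hom (B1 : C) (B2 : C)) :
  is_bimonoid_hom g -> is_bimonoid_hom f -> is_bimonoid_hom (g ∘ f).
Proof.
  intros [[gm gu] [gd ge]] [[fm fu] [fd fe]]; repeat split.
  - now rewrite <- comp_assoc, fm, comp_assoc, gm, tensm_comp, comp_assoc.
  - now rewrite <- comp_assoc, fu.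
  - now rewrite comp_assoc, gd, <- comp_assoc, fd, tensm_comp, comp_assoc.
  - now rewrite comp_assoc, ge.
Qed.

Definition bimon_id (B : Bimonoid C) : BimonHom B B :=
  exist _ (idm (B : C)) (bimonoid_hom_id B).

Definition bimon_comp (B1 B2 B3 : Bimonoid C)
    (g : BimonHom B2 B3) (f : BimonHom B1 B2) : BimonHom B1 B3 :=
  exist _ (proj1_sig g ∘ proj1_sig f)
    (bimonoid_hom_comp (proj2_sig g) (proj2_sig f)).

Lemma bimon_hom_eq (B1 B2 : Bimonoid C) (f g : BimonHom B1 B2) :
  proj1_sig f = proj1_sig g -> f = g.
Proof.
  destruct f as [f pf], g as [g pg]; simpl; intros ->.
  now rewrite (proof_irrelevance _ pf pg).
Qed.

Lemma bimon_idl (B1 B2 : Bimonoid C) (f : BimonHom B1 B2) :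
  bimon_comp (bimon_id B2) f = f.
Proof. apply bimon_hom_eq, comp_idl. Qed.

Lemma bimon_idr (B1 B2 : Bimonoid C) (f : BimonHom B1 B2) :
  bimon_comp f (bimon_id B1) = f.
Proof. apply bimon_hom_eq, comp_idr. Qed.

Lemma bimon_assoc (B1 B2 B3 B4 : Bimonoid C)
    (h : BimonHom B3 B4) (g : BimonHom B2 B3) (f : BimonHom B1 B2) :
  bimon_comp h (bimon_comp g f) = bimon_comp (bimon_comp h g) f.
Proof. apply bimon_hom_eq, comp_assoc. Qed.

Definition Bimon : Category := {|
  Obj := Bimonoid C;
  Hom := BimonHom;
  idm := bimon_id;
  comp := bimon_comp;
  comp_idl := bimon_idl;
  comp_idr := bimon_idr;
  comp_assoc := bimon_assoc
|}.

(** Homomorphisms of Hopf monoids are homomorphisms of the underlying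
    bimonoids: these preserve antipodes automatically. *)
Definition Hopf : Category := {|
  Obj := HopfMonoid C;
  Hom := fun H1 H2 => BimonHom H1 H2;
  idm := fun H => bimon_id H;
  comp := fun H1 H2 H3 g f => bimon_comp g f;
  comp_idl := fun H1 H2 f => bimon_idl f;
  comp_idr := fun H1 H2 f => bimon_idr f;
  comp_assoc := fun H1 H2 H3 H4 h g f => bimon_assoc h g f
|}.

Definition Hopf_to_Bimon : Functor Hopf Bimon := {|
  fobj := fun H : Hopf => hm_bim H : Bimon;
  fmap := fun H1 H2 f => f;
  fmap_id := fun H => eq_refl;
  fmap_comp := fun H1 H2 H3 g f => eq_refl
|}.
End CategoriesOfBimonoids.

(** With this bracketing [A^{⊗1}] is [one ⊗ A], identified with [A] by the
    suppressed unit constraint. *)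
Fixpoint tpow (C : MonoidalCategory) (A : C) (n : nat) : C :=
  match n with
  | O => one
  | S k => tpow A k ⊗ A
  end.

Record OmegaMagma (Omega : Type) (s t : Omega -> nat) (C : MonoidalCategory)
    : Type := {
  om_obj :> C;
  om_op : forall w : Omega, Hom (tpow om_obj (s w)) (tpow om_obj (t w))
}.

Definition ttens (C : BraidedCategory) (Q : C) (q : MonoidOn Q)
    (A1 A2 B1 B2 : C) (r1 : Hom A1 (B1 ⊗ Q)) (r2 : Hom A2 (B2 ⊗ Q))
    : Hom (A1 ⊗ A2) ((B1 ⊗ B2) ⊗ Q) :=
  (idm (B1 ⊗ B2) ⊗m mul q) ∘ midswap B1 Q B2 Q ∘ (r1 ⊗m r2).

Fixpoint ttens_pow (C : BraidedCategory) (Q : C) (q : MonoidOn Q)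
    (A B : C) (r : Hom A (B ⊗ Q)) (n : nat)
    : Hom (tpow A n) (tpow B n ⊗ Q) :=
  match n with
  | O => luniti Q ∘ unt q
  | S k => ttens q (ttens_pow q r k) r
  end.

Definition is_comeasuring (Omega : Type) (s t : Omega -> nat)
    (C : BraidedCategory) (A B : OmegaMagma s t C) (Q : C) (q : MonoidOn Q)
    (r : Hom (A : C) ((B : C) ⊗ Q)) : Prop :=
  forall w : Omega,
    ttens_pow q r (t w) ∘ om_op A w
    = (om_op B w ⊗m idm Q) ∘ ttens_pow q r (s w).

Definition is_comodule (C : MonoidalCategory) (A Q : C) (q : ComonoidOn Q)
    (r : Hom A (A ⊗ Q)) : Prop :=
  assoc A Q Q ∘ (r ⊗m idm Q) ∘ r = (idm A ⊗m comul q) ∘ r /\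
  runit A ∘ (idm A ⊗m counit q) ∘ r = idm A.

Definition is_coaction (Omega : Type) (s t : Omega -> nat)
    (C : BraidedCategory) (A : OmegaMagma s t C) (Q : Bimonoid C)
    (r : Hom (A : C) ((A : C) ⊗ (Q : C))) : Prop :=
  is_comeasuring (A := A) (B := A) (bm_mon Q) r /\ is_comodule (bm_com Q) r.

Section InternalHom.
Context (C : BraidedClosedCategory).

Definition ihom (A B : C) : C := ihomF A B.

Definition ev (A B : C) : Hom (ihom A B ⊗ A) B := adj_counit (ihom_adj A) B.

Definition curry (P A B : C) (psi : Hom (P ⊗ A) B) : Hom P (ihom A B) :=
  fmap (ihomF A) psi ∘ adj_unit (ihom_adj A) P.

Lemma ev_curry (P A B : C) (psi : Hom (P ⊗ A) B) :
  ev A B ∘ (curry psi ⊗m idm A) = psi.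
Proof. exact (adj_transposeK (ihom_adj A) psi). Qed.

Lemma curry_unique (P A B : C) (psi : Hom (P ⊗ A) B) (k : Hom P (ihom A B)) :
  ev A B ∘ (k ⊗m idm A) = psi -> k = curry psi.
Proof. exact (@adj_transpose_unique _ _ _ _ (ihom_adj A) P B psi k). Qed.

Lemma ev_inj (P A B : C) (k l : Hom P (ihom A B)) :
  ev A B ∘ (k ⊗m idm A) = ev A B ∘ (l ⊗m idm A) -> k = l.
Proof.
  intros e; rewrite (curry_unique e); symmetry; now apply curry_unique.
Qed.

Definition dual (A : C) : C := ihom A one.

Definition dual_map (A B Q : C) (r : Hom A (B ⊗ Q)) : Hom (dual Q ⊗ A) B :=
  runit B ∘ (idm B ⊗m ev Q one) ∘ assoc B (dual Q) Q
  ∘ (braid (dual Q) B ⊗m idm Q) ∘ associ (dual Q) B Q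
  ∘ (idm (dual Q) ⊗m r).
End InternalHom.

Section MonoidalLemmas.
Context (C : MonoidalCategory).

Lemma tensm_swap (X X' Y Y' : C) (f : Hom X X') (g : Hom Y Y') :
  (idm X' ⊗m g) ∘ (f ⊗m idm Y) = (f ⊗m idm Y') ∘ (idm X ⊗m g).
Proof. now rewrite <- !tensm_comp, !comp_idl, !comp_idr. Qed.

Lemma tensL_comp (X Y Z W : C) (g : Hom Y Z) (f : Hom X Y) :
  idm W ⊗m (g ∘ f) = (idm W ⊗m g) ∘ (idm W ⊗m f).
Proof. now rewrite <- tensm_comp, comp_idl. Qed.

Lemma lunit_faithful (X Y : C) (f g : Hom X Y) :
  idm one ⊗m f = idm one ⊗m g -> f = g.
Proof.
  intros e.
  rewrite <- (comp_idr f), <- (comp_idr g), <- (lunitiK X), !comp_assoc.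
  now rewrite <- !lunit_nat, e.
Qed.

Lemma assoc_epi (X Y Z W : C) (f g : Hom (X ⊗ (Y ⊗ Z)) W) :
  f ∘ assoc X Y Z = g ∘ assoc X Y Z -> f = g.
Proof.
  intros e.
  rewrite <- (comp_idr f), <- (comp_idr g), <- (associK X Y Z), !comp_assoc.
  now rewrite e.
Qed.

Lemma lunit_tens (X Y : C) :
  lunit (X ⊗ Y) ∘ assoc one X Y = lunit X ⊗m idm Y.
Proof.
  apply lunit_faithful, assoc_epi.
  assert (E : forall (U : C) (f g : Hom ((one ⊗ (one ⊗ X)) ⊗ Y) U),
    f ∘ (assoc one one X ⊗m idm Y) = g ∘ (assoc one one X ⊗m idm Y) ->
    f = g).
  { intros U f g e.
    rewrite <- (comp_idr f), <- (comp_idr g).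
    rewrite <- tensm_id, <- (associK one one X).
    rewrite <- (comp_idl (idm Y)), tensm_comp, !comp_assoc.
    now rewrite e. }
  apply E; clear E.
  rewrite tensL_comp, <- !comp_assoc.
  rewrite (comp_assoc (idm one ⊗m assoc one X Y)), <- pentagon.
  rewrite comp_assoc, triangle, (comp_assoc (idm one ⊗m _)).
  rewrite <- assoc_nat, <- comp_assoc, <- tensm_comp, triangle, comp_idl.
  now rewrite assoc_nat, tensm_id.
Qed.
End MonoidalLemmas.

Section EndMonoid.
Context (C : BraidedClosedCategory) (A : C).
Let E : C := ihom A A.
Let evA : Hom (E ⊗ A) A := ev A A.

Definition end_mul : Hom (E ⊗ E) E :=
  curry (evA ∘ (idm E ⊗m evA) ∘ assoc E E A).
Definition end_unt : Hom one E := curry (lunit A).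

(** These two equations say that [ev] is a left module structure on [A]; by
    [curry_unique] they determine [end_mul] and [end_unt]. *)
Lemma ev_end_mul :
  evA ∘ (end_mul ⊗m idm A) = evA ∘ (idm E ⊗m evA) ∘ assoc E E A.
Proof. apply ev_curry. Qed.

Lemma ev_end_unt : evA ∘ (end_unt ⊗m idm A) = lunit A.
Proof. apply ev_curry. Qed.

Lemma end_unitl : end_mul ∘ (end_unt ⊗m idm E) = lunit E.
Proof.
  apply ev_inj; fold evA.
  rewrite tensR_comp, comp_assoc, ev_end_mul.
  rewrite <- (comp_assoc _ (assoc _ _ _)), assoc_nat, tensm_id.
  rewrite comp_assoc, <- (comp_assoc evA), tensm_swap, comp_assoc.
  rewrite ev_end_unt, lunit_nat, <- comp_assoc.
  now rewrite lunit_tens.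
Qed.

Lemma end_unitr : end_mul ∘ (idm E ⊗m end_unt) = runit E.
Proof.
  apply ev_inj; fold evA.
  rewrite tensR_comp, comp_assoc, ev_end_mul.
  rewrite <- (comp_assoc _ (assoc _ _ _)), assoc_nat.
  rewrite comp_assoc, <- (comp_assoc evA), <- tensL_comp, ev_end_unt.
  now rewrite <- comp_assoc, triangle.
Qed.

Lemma end_assoc :
  end_mul ∘ (end_mul ⊗m idm E)
  = end_mul ∘ (idm E ⊗m end_mul) ∘ assoc E E E.
Proof.
  apply ev_inj; fold evA.
  rewrite !tensR_comp, !comp_assoc, ev_end_mul.
  transitivity (evA ∘ (idm E ⊗m evA) ∘ (idm E ⊗m (idm E ⊗m evA))
                ∘ assoc E E (E ⊗ A) ∘ assoc (E ⊗ E) E A).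
  - rewrite <- (comp_assoc _ (assoc _ _ _)), assoc_nat, tensm_id.
    rewrite comp_assoc, <- (comp_assoc evA), tensm_swap, comp_assoc.
    rewrite ev_end_mul.
    rewrite <- (comp_assoc _ (assoc E E A)).
    rewrite <- (tensm_id E E), assoc_nat.
    now rewrite comp_assoc.
  - rewrite <- (comp_assoc _ (assoc E E A) ((idm E ⊗m end_mul) ⊗m idm A)).
    rewrite assoc_nat, (comp_assoc _ (idm E ⊗m (end_mul ⊗m idm A))).
    rewrite <- (comp_assoc evA _ (idm E ⊗m (end_mul ⊗m idm A))).
    rewrite <- tensL_comp, ev_end_mul, !tensL_comp, !comp_assoc.
    rewrite <- (comp_assoc _ (assoc E E (E ⊗ A))), pentagon.
    now rewrite !comp_assoc.
Qed.

Definition end_monoid : MonoidOn (ihom A A) := {|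
  mul := end_mul;
  unt := end_unt;
  mul_assoc := end_assoc;
  mul_unitl := end_unitl;
  mul_unitr := end_unitr
|}.
End EndMonoid.

Section Coactions.
Context (Omega : Type) (s t : Omega -> nat) (C : BraidedClosedCategory).
Context (A : OmegaMagma s t C) (V : Submonoid (end_monoid (A : C))).

Definition factors_through_V (Q : C) (r : Hom (A : C) ((A : C) ⊗ Q))
    : Prop :=
  exists f : Hom (dual Q) (sub_obj V), curry (dual_map r) = sub_incl V ∘ f.

Record VCoaction : Type := {
  vc_bim : Bimonoid C;
  vc_rho : Hom (A : C) ((A : C) ⊗ (vc_bim : C));
  vc_coaction : is_coaction (A := A) (Q := vc_bim) vc_rho;
  vc_factors : factors_through_V vc_rho
}.

Record VHCoaction : Type := {
  vh_hopf : HopfMonoid C;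
  vh_rho : Hom (A : C) ((A : C) ⊗ (vh_hopf : C));
  vh_coaction : is_coaction (A := A) (Q := vh_hopf) vh_rho;
  vh_factors : factors_through_V vh_rho
}.

Section Intertwine.
Context (B1 B2 B3 : Bimonoid C).

Definition intertwines (r1 : Hom (A : C) ((A : C) ⊗ (B1 : C)))
    (r2 : Hom (A : C) ((A : C) ⊗ (B2 : C))) (f : BimonHom B1 B2) : Prop :=
  (idm (A : C) ⊗m proj1_sig f) ∘ r1 = r2.
End Intertwine.

Lemma intertwines_id (B : Bimonoid C) (r : Hom (A : C) ((A : C) ⊗ (B : C))) :
  intertwines r r (bimon_id B).
Proof. unfold intertwines; simpl; now rewrite tensm_id, comp_idl. Qed.

Lemma intertwines_comp (B1 B2 B3 : Bimonoid C) r1 r2 r3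
    (g : BimonHom B2 B3) (f : BimonHom B1 B2) :
  intertwines r2 r3 g -> intertwines r1 r2 f ->
  intertwines r1 r3 (bimon_comp g f).
Proof.
  unfold intertwines; simpl; intros <- <-.
  now rewrite tensL_comp, comp_assoc.
Qed.

Definition CoactHom (B1 B2 : Bimonoid C) r1 r2 : Type :=
  { f : BimonHom B1 B2 | intertwines r1 r2 f }.

Lemma coact_hom_eq (B1 B2 : Bimonoid C) r1 r2
    (f g : @CoactHom B1 B2 r1 r2) :
  proj1_sig f = proj1_sig g -> f = g.
Proof.
  destruct f as [f pf], g as [g pg]; simpl; intros ->.
  now rewrite (proof_irrelevance _ pf pg).
Qed.

Definition coact_id (B : Bimonoid C) r : @CoactHom B B r r :=
  exist _ (bimon_id B) (intertwines_id r).

Definition coact_comp (B1 B2 B3 : Bimonoid C) r1 r2 r3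
    (g : @CoactHom B2 B3 r2 r3) (f : @CoactHom B1 B2 r1 r2)
    : @CoactHom B1 B3 r1 r3 :=
  exist _ (bimon_comp (proj1_sig g) (proj1_sig f))
    (intertwines_comp (proj2_sig g) (proj2_sig f)).

Lemma coact_idl (B1 B2 : Bimonoid C) r1 r2 (f : @CoactHom B1 B2 r1 r2) :
  coact_comp (coact_id r2) f = f.
Proof. apply coact_hom_eq, bimon_idl. Qed.

Lemma coact_idr (B1 B2 : Bimonoid C) r1 r2 (f : @CoactHom B1 B2 r1 r2) :
  coact_comp f (coact_id r1) = f.
Proof. apply coact_hom_eq, bimon_idr. Qed.

Lemma coact_assoc (B1 B2 B3 B4 : Bimonoid C) r1 r2 r3 r4
    (h : @CoactHom B3 B4 r3 r4) (g : @CoactHom B2 B3 r2 r3)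
    (f : @CoactHom B1 B2 r1 r2) :
  coact_comp h (coact_comp g f) = coact_comp (coact_comp h g) f.
Proof. apply coact_hom_eq, bimon_assoc. Qed.

Definition Coact_V : Category := {|
  Obj := VCoaction;
  Hom := fun X Y => CoactHom (vc_rho X) (vc_rho Y);
  idm := fun X => coact_id (vc_rho X);
  comp := fun X Y Z g f => coact_comp g f;
  comp_idl := fun X Y f => coact_idl f;
  comp_idr := fun X Y f => coact_idr f;
  comp_assoc := fun X Y Z W h g f => coact_assoc h g f
|}.

Definition HCoact_V : Category := {|
  Obj := VHCoaction;
  Hom := fun X Y => CoactHom (vh_rho X) (vh_rho Y);
  idm := fun X => coact_id (vh_rho X);
  comp := fun X Y Z g f => coact_comp g f;
  comp_idl := fun X Y f => coact_idl f;
  comp_idr := fun X Y f => coact_idr f;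
  comp_assoc := fun X Y Z W h g f => coact_assoc h g f
|}.
End Coactions.

(* Main.v *)
Require Import Defs.
From Stdlib Require Import Setoid.

(** The universal coacting Hopf monoid is the Hopf envelope of the universal
    coacting bimonoid.  Let [rho] be the universal coaction of [B] and let
    [eta] be the unit of the adjunction at [B], a bimonoid homomorphism from
    [B] to the Hopf monoid [Hl B].  A coaction can be pushed forward along any
    bimonoid homomorphism [f] ([coaction_push]), and the pushforward still
    factors through [V], because on the dual side it merely precomposes
    [K(rho^vee)] with the transpose of [f] ([curry_dual_map_push]).  Hence
    [(id ⊗ eta) rho] is an object of [HCoact_V V].

    It is initial because the morphisms from it to a Hopf coaction [rho'] of
    [H'] correspond, by precomposition with [eta], to the bimonoid
    homomorphisms from [B] to [H'] intertwining [rho] and [rho'], and there is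
    exactly one of these. *)

Set Implicit Arguments.
Unset Strict Implicit.
Unset Printing Implicit Defensive.

(** * Naturality of the structural morphisms *)

Lemma associ_nat (C : MonoidalCategory) (X X' Y Y' Z Z' : C)
    (f : Hom X X') (g : Hom Y Y') (h : Hom Z Z') :
  associ X' Y' Z' ∘ (f ⊗m (g ⊗m h)) = ((f ⊗m g) ⊗m h) ∘ associ X Y Z.
Proof.
  rewrite <- (comp_idr (f ⊗m (g ⊗m h))), <- associK.
  rewrite (comp_assoc (f ⊗m _)), <- assoc_nat, !comp_assoc.
  now rewrite assocK, comp_idl.
Qed.

Lemma midswap_nat (C : BraidedCategory) (X X' Y Y' Z Z' W W' : C)
    (f : Hom X X') (g : Hom Y Y') (h : Hom Z Z') (k : Hom W W') :
  midswap X' Y' Z' W' ∘ ((f ⊗m g) ⊗m (h ⊗m k))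
  = ((f ⊗m h) ⊗m (g ⊗m k)) ∘ midswap X Y Z W.
Proof.
  assert (inner :
    assoc Z' Y' W' ∘ (braid Y' Z' ⊗m idm W') ∘ associ Y' Z' W'
      ∘ (g ⊗m (h ⊗m k))
    = (h ⊗m (g ⊗m k))
      ∘ (assoc Z Y W ∘ (braid Y Z ⊗m idm W) ∘ associ Y Z W)).
  { rewrite <- (comp_assoc _ (associ _ _ _)), associ_nat, !comp_assoc.
    rewrite <- (comp_assoc _ (braid _ _ ⊗m _)), <- tensm_comp.
    rewrite braid_nat, comp_idl, <- (comp_idr k) at 1.
    rewrite tensm_comp, comp_assoc, assoc_nat.
    reflexivity. }
  unfold midswap.
  rewrite <- comp_assoc, assoc_nat, !comp_assoc.
  rewrite <- (comp_assoc (associ _ _ _)), <- tensm_comp, inner, comp_idl.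
  rewrite <- (comp_idr f) at 1.
  now rewrite tensm_comp, comp_assoc, associ_nat.
Qed.

(** * Pushing coactions forward *)

Section PushMonoid.
Context (C : BraidedCategory) (Q Q' : C) (q : MonoidOn Q) (q' : MonoidOn Q').
Context (f : Hom Q Q') (hf : is_monoid_hom q q' f).

Lemma ttens_push (A1 A2 B1 B2 : C)
    (r1 : Hom A1 (B1 ⊗ Q)) (r2 : Hom A2 (B2 ⊗ Q)) :
  ttens q' ((idm B1 ⊗m f) ∘ r1) ((idm B2 ⊗m f) ∘ r2)
  = (idm (B1 ⊗ B2) ⊗m f) ∘ ttens q r1 r2.
Proof.
  unfold ttens.
  rewrite tensm_comp, comp_assoc, <- (comp_assoc _ (midswap _ _ _ _)).
  rewrite midswap_nat, !comp_assoc, tensm_id, <- !tensL_comp.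
  now rewrite (proj1 hf).
Qed.

Lemma ttens_pow_push (A B : C) (r : Hom A (B ⊗ Q)) (n : nat) :
  ttens_pow q' ((idm B ⊗m f) ∘ r) n
  = (idm (tpow B n) ⊗m f) ∘ ttens_pow q r n.
Proof.
  induction n as [|n IH]; simpl.
  - (* [luniti] is natural, being inverse to [lunit] *)
    rewrite <- (proj2 hf), !comp_assoc; f_equal.
    rewrite <- (comp_idr f) at 1.
    rewrite <- (lunitiK Q), (comp_assoc f), <- lunit_nat, !comp_assoc.
    now rewrite lunitK, comp_idl.
  - now rewrite IH, ttens_push.
Qed.

Lemma comeasuring_push (Omega : Type) (s t : Omega -> nat)
    (A B : OmegaMagma s t C) (r : Hom (A : C) ((B : C) ⊗ Q)) :
  is_comeasuring (A := A) (B := B) q r ->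
  is_comeasuring (A := A) (B := B) q' ((idm (B : C) ⊗m f) ∘ r).
Proof.
  intros hr w.
  rewrite !ttens_pow_push, <- comp_assoc, hr, !comp_assoc.
  now rewrite tensm_swap.
Qed.
End PushMonoid.

Lemma comodule_push (C : MonoidalCategory) (A Q Q' : C)
    (q : ComonoidOn Q) (q' : ComonoidOn Q') (f : Hom Q Q') (r : Hom A (A ⊗ Q)) :
  is_comonoid_hom q q' f -> is_comodule q r ->
  is_comodule q' ((idm A ⊗m f) ∘ r).
Proof.
  intros [fd fe] [rd re]; split.
  - rewrite (comp_assoc (idm A ⊗m comul q')), <- tensL_comp, fd.
    rewrite tensL_comp, <- (comp_assoc _ _ r), <- rd, !comp_assoc.
    rewrite <- assoc_nat, <- !(comp_assoc (assoc A Q' Q')).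
    rewrite <- !tensm_comp.
    now rewrite comp_idl, !comp_idr.
  - rewrite comp_assoc, <- (comp_assoc (runit A)), <- tensL_comp.
    now rewrite fe.
Qed.

Lemma coaction_push (Omega : Type) (s t : Omega -> nat) (C : BraidedCategory)
    (A : OmegaMagma s t C) (Q Q' : Bimonoid C) (f : BimonHom Q Q')
    (r : Hom (A : C) ((A : C) ⊗ (Q : C))) :
  is_coaction (A := A) (Q := Q) r ->
  is_coaction (A := A) (Q := Q') ((idm (A : C) ⊗m proj1_sig f) ∘ r).
Proof.
  destruct f as [f [fm fc]]; intros [hm hc]; split; simpl.
  - now apply comeasuring_push with (bm_mon Q).
  - now apply comodule_push with (bm_com Q).
Qed.

(** * The dual side *)

Section Duals.
Context (C : BraidedClosedCategory).

Definition dual_mor (Q Q' : C) (f : Hom Q Q') : Hom (dual Q') (dual Q) :=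
  curry (ev Q' one ∘ (idm (dual Q') ⊗m f)).

Lemma ev_dual_mor (Q Q' : C) (f : Hom Q Q') :
  ev Q one ∘ (dual_mor f ⊗m idm Q) = ev Q' one ∘ (idm (dual Q') ⊗m f).
Proof. exact (ev_curry _). Qed.

Lemma curry_precomp (P P' A B : C) (k : Hom P' P) (psi : Hom (P ⊗ A) B) :
  curry (psi ∘ (k ⊗m idm A)) = curry psi ∘ k.
Proof.
  symmetry; apply curry_unique.
  now rewrite tensR_comp, comp_assoc, ev_curry.
Qed.

(** Both sides evaluate the [Q]-leg of [r], transported to [Q'], against the
    functional in [dual Q']: moving [f] onto the functional is the defining
    property of [dual_mor f], [ev_dual_mor]. *)
Lemma dual_map_push (A B Q Q' : C) (f : Hom Q Q') (r : Hom A (B ⊗ Q)) :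
  dual_map ((idm B ⊗m f) ∘ r) = dual_map r ∘ (dual_mor f ⊗m idm A).
Proof.
  unfold dual_map.
  transitivity (runit B ∘ (idm B ⊗m (ev Q' one ∘ (idm (dual Q') ⊗m f)))
                ∘ assoc B (dual Q') Q ∘ (braid (dual Q') B ⊗m idm Q)
                ∘ associ (dual Q') B Q ∘ (idm (dual Q') ⊗m r)).
  - rewrite tensL_comp, comp_assoc; f_equal.
    rewrite <- (comp_assoc _ (associ _ _ _)), associ_nat, tensm_id.
    rewrite comp_assoc; f_equal.
    rewrite <- (comp_assoc _ (_ ⊗m idm Q')), <- tensm_swap.
    rewrite comp_assoc; f_equal.
    rewrite <- (tensm_id B (dual Q')).
    rewrite <- (comp_assoc _ (assoc _ _ _)), assoc_nat, comp_assoc; f_equal.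
    now rewrite <- (comp_assoc (runit B)), <- tensL_comp.
  - rewrite <- (comp_assoc _ (_ ⊗m r)), tensm_swap, comp_assoc; f_equal.
    rewrite <- (comp_assoc _ (associ _ _ _)), <- (tensm_id B Q), associ_nat.
    rewrite comp_assoc; f_equal.
    rewrite <- (comp_assoc _ (_ ⊗m idm Q)), <- tensR_comp, braid_nat.
    rewrite tensR_comp, comp_assoc; f_equal.
    rewrite <- (comp_assoc _ (assoc _ _ _)), assoc_nat, comp_assoc; f_equal.
    rewrite <- (comp_assoc (runit B)), <- tensL_comp.
    now rewrite ev_dual_mor.
Qed.

Lemma curry_dual_map_push (A B Q Q' : C) (f : Hom Q Q') (r : Hom A (B ⊗ Q)) :
  curry (dual_map ((idm B ⊗m f) ∘ r)) = curry (dual_map r) ∘ dual_mor f.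
Proof. now rewrite dual_map_push, curry_precomp. Qed.

Lemma factors_through_V_push (Omega : Type) (s t : Omega -> nat)
    (A : OmegaMagma s t C) (V : Submonoid (end_monoid (A : C)))
    (Q Q' : C) (f : Hom Q Q') (r : Hom (A : C) ((A : C) ⊗ Q)) :
  factors_through_V V r -> factors_through_V V ((idm (A : C) ⊗m f) ∘ r).
Proof.
  intros [k hk]; exists (k ∘ dual_mor f).
  now rewrite curry_dual_map_push, hk, comp_assoc.
Qed.
End Duals.

(** * The universal coacting Hopf monoid *)

Theorem theorem4p23 (Omega : Type) (s t : Omega -> nat)
    (C : BraidedClosedCategory) (hC : ExtrEpi_Mono_structured C)
    (A : OmegaMagma s t C)
    (V : Submonoid (end_monoid (om_obj A)))
    (hB : has_initial (Coact_V V))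
    (Hl : Functor (Bimon C) (Hopf C))
    (adj : Adjunction Hl (Hopf_to_Bimon C)) :
  has_initial (HCoact_V V).
Proof.
  destruct hB as [[B rho hrho hV] init].
  set (eta := adj_unit adj B : BimonHom B (hm_bim (Hl B))).
  exists {| vh_rho := (idm (A : C) ⊗m proj1_sig eta) ∘ rho;
            vh_coaction := coaction_push eta hrho;
            vh_factors := factors_through_V_push (proj1_sig eta) hV |}.
  intros [H rho' hrho' hV'].
  destruct (init {| vc_rho := rho'; vc_coaction := hrho'; vc_factors := hV' |})
    as [[phi hphi] uniq]; simpl in *.
  (* the adjoint transpose of [phi] *)
  set (psi := adj_counit adj H ∘ fmap Hl (phi : @Hom (Bimon C) B (hm_bim H))
              : @Hom (Hopf C) (Hl B) H).
  assert (psi_eta : bimon_comp psi eta = phi).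
  { change (fmap (Hopf_to_Bimon C) psi ∘ adj_unit adj B
            = (phi : @Hom (Bimon C) B (Hopf_to_Bimon C H))).
    symmetry; now apply adj_transpose_unique. }
  assert (hpsi : intertwines ((idm (A : C) ⊗m proj1_sig eta) ∘ rho) rho' psi).
  { unfold intertwines.
    rewrite comp_assoc, <- tensL_comp.
    change (proj1_sig psi ∘ proj1_sig eta) with (proj1_sig (bimon_comp psi eta)).
    now rewrite psi_eta. }
  exists (exist _ psi hpsi).
  intros [g hg]; apply coact_hom_eq; simpl.
  assert (g_eta : bimon_comp g eta = phi).
  { assert (hge : intertwines rho rho' (bimon_comp g eta))
      by now apply intertwines_comp with ((idm (A : C) ⊗m proj1_sig eta) ∘ rho).
    exact (f_equal (@proj1_sig _ _) (uniq (exist _ _ hge))). }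
  rewrite <- (adj_transposeK adj (g : @Hom (Hopf C) (Hl B) H)).
  unfold psi; rewrite <- g_eta.
  reflexivity.
Qed.
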